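(* Let $X\subset\mathbb{R}^n$ be a closed and unbounded set, let $I=\{1,\ldots,m\}$, and let $f=(f_1,\ldots,f_m):\mathbb{R}^n\to\mathbb{R}^m$ be such that each $f_i:\mathbb{R}^n\to\mathbb{R}$, $i\in I$, is lower semicontinuous. Assume that $$X^{\infty}\cap\Big(\bigcup_{i\in I}\mathcal{K}(f_i)\Big)=\{0\}.$$ Then there exists $\varepsilon>0$ such that for all $u\in\mathbb{R}^{m\times n}$ satisfying $\|u\|<\varepsilon$, the following statements hold: (a) $f^u$ is bounded from below on $X$, i.e., there exists $a\in\mathbb{R}^m$ with $f^u(X)\subset a+\mathbb{R}^m_+$. (b) For all $\lambda\in\Lambda$, the function $\varphi^u_\lambda(\cdot):=\langle\lambda,f^u(\cdot)\rangle$ is coercive on $X$, i.e., $\varphi^u_\lambda(x)\to+\infty$ as $\|x\|\to\infty$ with $x\in X$. (c) $\mathrm{Sol}^w(u)$ is nonempty and compact. (d) $\mathop{\mathrm{Lim\,sup}}_{u\to 0}\mathrm{Sol}^w(u)\subset\mathrm{Sol}^w(0)$, i.e., the solution mapping $\mathrm{Sol}^w(\cdot)$ is closed at $0$. (e) $\mathrm{Sol}^w(\cdot)$ is upper semicontinuous at $0$.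
   Context: All spaces are Euclidean; $\mathbb{R}^m_+$ is the nonnegative orthant; $\Lambda:=\{\lambda\in\mathbb{R}^m_+:\sum_{i=1}^m\lambda_i=1\}$. For $u=(u_1,\ldots,u_m)\in\mathbb{R}^{m\times n}$ with $u_i\in\mathbb{R}^n$, $\|u\|:=\max_{i\in I}\|u_i\|$ (Euclidean norms of the $u_i$), and $f^u:=(f_1^{u_1},\ldots,f_m^{u_m})$ with $f_i^{u_i}(x):=f_i(x)-\langle u_i,x\rangle$. $\mathrm{Sol}^w(u)$ is the set of weak Pareto solutions of minimizing $f^u$ over $X$, i.e., of all $\bar x\in X$ such that there is no $x\in X$ with $f_i^{u_i}(x)<f_i^{u_i}(\bar x)$ for all $i\in I$. Asymptotic cone: $X^\infty:=\{d\in\mathbb{R}^n:\exists\, t_k\to+\infty,\ \exists\, x_k\in X,\ x_k/t_k\to d\}$. Asymptotic function of $\varphi:\mathbb{R}^n\to\mathbb{R}$: $\varphi^\infty(d):=\inf\{\liminf_{k\to\infty}\varphi(t_kd_k)/t_k:\ t_k\to+\infty,\ d_k\to d\}$. $\mathcal{K}(\varphi):=\{d\in\mathbb{R}^n:\varphi^\infty(d)\le 0\}$. For a set-valued mapping $F$: $\mathop{\mathrm{Lim\,sup}}_{u\to\bar u}F(u)$ is the set of all $y$ for which there exist sequences $u_k\to\bar u$, $y_k\to y$ with $y_k\in F(u_k)$ for all $k$. $F$ is upper semicontinuous at $\bar u$ if for every open set $V\supset F(\bar u)$ there is a neighborhood $U$ of $\bar u$ with $F(u)\subset V$ for all $u\in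 U$. *)

(* Defs.v *)
From HB Require Import structures.
From mathcomp Require Import all_boot all_order all_algebra.
From mathcomp Require Import all_classical all_reals all_analysis.

Set Implicit Arguments.
Unset Strict Implicit.
Unset Printing Implicit Defensive.

Import Order.TTheory GRing.Theory Num.Theory.
Import numFieldNormedType.Exports.

Local Open Scope classical_set_scope.
Local Open Scope ring_scope.

(* R^n is 'rV[R]_n with its library (product) topology, which is the Euclidean
   topology.  The library norm `|x| on 'rV[R]_n is the max norm, so wherever
   the value of a Euclidean norm matters, enorm is used instead. *)

Definition inner (R : realType) (n : nat) (x y : 'rV[R]_n) : R :=
  \sum_(j < n) x ord0 j * y ord0 j.

Definition enorm (R : realType) (n : nat) (x : 'rV[R]_n) : R :=
  Num.sqrt (inner x x).

(* u_i is row i u; the default 0 of the max is harmless as norms are >= 0. *)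
Definition pert_norm (R : realType) (m n : nat) (u : 'M[R]_(m, n)) : R :=
  \big[Num.max/0]_(i < m) enorm (row i u).

Definition orthant (R : realType) (m : nat) : set 'rV[R]_m :=
  [set v | forall i, 0 <= v ord0 i].

Definition weights (R : realType) (m : nat) : set 'rV[R]_m :=
  [set l | orthant l /\ \sum_(i < m) l ord0 i = 1].

Definition component (R : realType) (m n : nat) (f : 'rV[R]_n -> 'rV[R]_m)
    (i : 'I_m) : 'rV[R]_n -> R :=
  fun x => f x ord0 i.

Definition perturb (R : realType) (m n : nat) (f : 'rV[R]_n -> 'rV[R]_m)
    (u : 'M[R]_(m, n)) : 'rV[R]_n -> 'rV[R]_m :=
  fun x => \row_(i < m) (component f i x - inner (row i u) x).

Definition weak_pareto (R : realType) (m n : nat) (X : set 'rV[R]_n)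
    (g : 'rV[R]_n -> 'rV[R]_m) : set 'rV[R]_n :=
  [set xb | X xb /\
     ~ exists x, X x /\ forall i : 'I_m, component g i x < component g i xb].

Definition Solw (R : realType) (m n : nat) (X : set 'rV[R]_n)
    (f : 'rV[R]_n -> 'rV[R]_m) (u : 'M[R]_(m, n)) : set 'rV[R]_n :=
  weak_pareto X (perturb f u).

(* In the next two definitions t tends to +oo, so the finitely many indices k
   with t k <= 0 (where t k may have the junk inverse 0^-1 = 0) are
   irrelevant. *)
Definition asymptotic_cone (R : realType) (n : nat) (X : set 'rV[R]_n) :
    set 'rV[R]_n :=
  [set d : 'rV[R]_n | exists (t : nat -> R) (x : nat -> 'rV[R]_n),
     [/\ t k @[k --> \oo] --> +oo,
         forall k, X (x k) &
         (t k)^-1 *: x k @[k --> \oo] --> d]].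

Definition asymptotic_function (R : realType) (n : nat) (phi : 'rV[R]_n -> R)
    (d : 'rV[R]_n) : \bar R :=
  ereal_inf [set l : \bar R | exists (t : nat -> R) (e : nat -> 'rV[R]_n),
     [/\ t k @[k --> \oo] --> +oo,
         e k @[k --> \oo] --> d &
         l = limn_einf (fun k => (phi (t k *: e k) / t k)%:E)]].

Definition asymptotic_kernel (R : realType) (n : nat) (phi : 'rV[R]_n -> R) :
    set 'rV[R]_n :=
  [set d | (asymptotic_function phi d <= 0)%E].

Definition bounded_below_on (R : realType) (m n : nat) (X : set 'rV[R]_n)
    (g : 'rV[R]_n -> 'rV[R]_m) : Prop :=
  exists a : 'rV[R]_m, g @` X `<=` [set a + v | v in @orthant R m].

Definition coercive_on (R : realType) (n : nat) (X : set 'rV[R]_n)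
    (phi : 'rV[R]_n -> R) : Prop :=
  forall M : R, exists r : R, forall x, X x -> r < enorm x -> M < phi x.

Definition outer_limit (S T : topologicalType) (F : S -> set T) (ub : S) :
    set T :=
  [set y : T | exists (u_ : nat -> S) (y_ : nat -> T),
     [/\ u_ k @[k --> \oo] --> ub,
         y_ k @[k --> \oo] --> y &
         forall k, F (u_ k) (y_ k)]].

Definition upper_semicontinuous_at (S T : topologicalType) (F : S -> set T)
    (ub : S) : Prop :=
  forall V : set T, open V -> F ub `<=` V -> \forall u \near ub, F u `<=` V.

(* Main.v *)
Require Import Defs.
From HB Require Import structures.
From mathcomp Require Import all_boot all_order all_algebra.
From mathcomp Require Import all_classical all_reals all_analysis.
From mathcomp Require Import lra.

Import Order.TTheory GRing.Theory Num.Theory.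
Import numFieldNormedType.Exports.

Local Open Scope classical_set_scope.
Local Open Scope ring_scope.

(** The asymptotic hypothesis forces a uniform linear growth on [X]: there are
    [c > 0] and [b] with [c * |x| - b <= f_i x] for all [i] and all [x] in [X].
    Otherwise some sequence in [X] escapes to infinity with
    [limsup f_i (x_k) / |x_k| <= 0]; by compactness of the unit sphere its
    directions accumulate at a unit vector, which lies in the asymptotic cone
    of [X] and in the asymptotic kernel of [f_i]: a contradiction
    ([linear_growth_outside_ball]). The remaining bounded part of [X] only costs
    a constant, since a lower semicontinuous function is bounded below on a
    compact set ([linear_growth]).

    A perturbation [u] changes [f_i] by a linear term of slope [O(|u|)], so for
    small [u] all [f^u_i] still grow with the common slope [c / 2]
    ([perturb_linear_growth]). Boundedness below (a) and coercivity (b) are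
    immediate. Comparing a weak Pareto point with one fixed point of [X] bounds
    [Sol^w(u)] uniformly in [u] ([linear_growth_weak_pareto_bounded]), and the
    minimizers over [X] of a single [f^u_i] exist and are weak Pareto
    ([linear_growth_weak_pareto_nonempty]).

    The other ingredient is that the graph of [Sol^w] is closed
    ([closed_graph_Solw]), because [(u, y) |-> f^u_i y] is jointly lower
    semicontinuous. It gives the closedness of [Sol^w(u)], hence compactness
    (c), the outer limit inclusion (d), and, combined with the local uniform
    bound, upper semicontinuity (e) ([closed_graph_usc]).

    Convergence and compactness are handled in the max norm [`|x|]; the
    Euclidean norm enters only through [enorm_le], for coercivity, and
    [mx_norm_le_pert_norm], for the size of the perturbation. *)

(** * Norm comparisons and continuity *)

Lemma mx_entry_le_norm (R : realType) (m n : nat) (u : 'M[R]_(m, n)) i j :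
  `|u i j| <= `|u|.
Proof.
rewrite [leRHS]/Num.norm /= mx_normrE.
exact: (le_bigmax 0 (fun ij : 'I_m * 'I_n => `|u ij.1 ij.2|) (i, j)).
Qed.

Lemma enorm_le (R : realType) (n : nat) (x : 'rV[R]_n) :
  enorm x <= n%:R * `|x|.
Proof.
rewrite /enorm -[leRHS]ger0_norm ?mulr_ge0// -sqrtr_sqr.
apply: ler_wsqrtr; rewrite /inner.
apply: (@le_trans _ _ (\sum_(j < n) `|x| ^+ 2)).
  apply: ler_sum => j _; rewrite -expr2 -real_normK ?num_real//.
  by rewrite ler_pXn2r ?nnegrE// mx_entry_le_norm.
rewrite sumr_const card_ord exprMn -[leLHS]mulr_natl.
apply: ler_wpM2r; first exact: sqr_ge0.
by rewrite -natrX ler_nat; case: n x => // n x; rewrite leq_pmulr.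
Qed.

Lemma mx_norm_le_pert_norm (R : realType) (m n : nat) (u : 'M[R]_(m, n)) :
  `|u| <= pert_norm u.
Proof.
have pert_ge0 : 0 <= pert_norm u.
  by apply: bigmax_ge_id.
rewrite [leLHS]/Num.norm /= mx_normrE; apply/bigmax_leP; split=> // -[i j] _ /=.
apply: le_trans (le_bigmax 0 (fun i => enorm (row i u)) i).
rewrite /enorm -sqrtr_sqr; apply: ler_wsqrtr.
rewrite /inner (bigD1 j)//= !mxE -expr2 lerDl.
by apply: sumr_ge0 => k _; rewrite -expr2 sqr_ge0.
Qed.

Lemma inner_row_le (R : realType) (m n : nat) (u : 'M[R]_(m, n)) i
    (x : 'rV[R]_n) :
  `|inner (row i u) x| <= n%:R * `|u| * `|x|.
Proof.
apply: (le_trans (ler_norm_sum _ _ _)).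
apply: (@le_trans _ _ (\sum_(j < n) `|u| * `|x|)).
  by apply: ler_sum => j _; rewrite normrM ler_pM// ?mxE mx_entry_le_norm.
by rewrite sumr_const card_ord -[leLHS]mulr_natl mulrA.
Qed.

Lemma continuous_pair (S T U : topologicalType) (g : S -> T) (h : S -> U) :
  continuous g -> continuous h -> continuous (fun x => (g x, h x)).
Proof. by move=> g_cont h_cont x; exact: cvg_pair (g_cont x) (h_cont x). Qed.

Lemma continuous_pairr (T U : topologicalType) (y : T) :
  continuous (fun x : U => (y, x)).
Proof.
apply: (@continuous_pair _ _ _ (fun=> y) id); first exact: cst_continuous.
by move=> x; exact: cvg_id.
Qed.

Lemma continuous_inner_row (R : realType) (m n : nat) (i : 'I_m) :
  continuous (fun p : 'M[R]_(m, n) * 'rV[R]_n => inner (row i p.1) p.2).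
Proof.
apply: continuous_big => [|j _]; first exact: add_continuous.
move=> p; apply: cvgM; last first.
  apply: (@continuous_comp _ _ _ snd (fun x : 'rV[R]_n => x ord0 j)).
    exact: cvg_snd.
  exact: coord_continuous.
under eq_fun do rewrite mxE.
rewrite mxE.
apply: (@continuous_comp _ _ _ fst (fun u : 'M[R]_(m, n) => u i j)).
  exact: cvg_fst.
exact: coord_continuous.
Qed.

(** * Lower semicontinuous functions on compact sets *)

(** The description of lower semicontinuity by open superlevel sets is the form
    in which real-valued functions are handled below. *)
Lemma lsc_open_gt (R : realType) (T : topologicalType) (g : T -> R) :
  lower_semicontinuous (EFin \o g) -> forall a, open [set x | a < g x].
Proof.
move=> /lower_semicontinuousP g_lsc a; have := g_lsc a.
by under eq_set do rewrite /= lte_fin.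
Qed.

Lemma open_continuous_lt_lsc (R : realType) (T : topologicalType)
    (h g : T -> R) :
  continuous h -> (forall a, open [set x | a < g x]) ->
  open [set x | h x < g x].
Proof.
move=> h_cont g_lsc; rewrite openE => x /= hgx.
have [hb bg] := midf_lt hgx; set b := _ / _ in hb bg.
have near_h : \forall y \near x, h y < b by exact: (cvgr_lt _ (h_cont x)).
have near_g : \forall y \near x, b < g y.
  by apply: open_nbhs_nbhs; split; [exact: g_lsc|].
by apply: filterS2 near_h near_g => y; exact: lt_trans.
Qed.

(** Near each point of [K] the function exceeds some constant; compactness, as
    [near_covering] along the filter at [-oo], makes one constant work for
    all of [K]. *)
Lemma compact_lsc_lbound (R : realType) (T : topologicalType) (K : set T)
    (g : T -> R) :
  compact K -> (forall a, open [set x | a < g x]) ->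
  exists a, forall x, K x -> a < g x.
Proof.
move=> /compact_near_coveringP K_cov g_lsc.
suff /filter_ex[a Ka] : \forall a \near -oo, K `<=` [set x | a < g x].
  by exists a.
apply: K_cov => x _.
exists ([set y | g x - 1 < g y], [set a | a < g x - 1]) => /=; last first.
  by move=> [y a] /= [gy ay]; exact: lt_trans ay gy.
split; last exact: nbhs_ninfty_lt (num_real _).
by apply: open_nbhs_nbhs; split; [exact: g_lsc|rewrite /= gtrBl].
Qed.

(** If the infimum were not attained, [g] would locally exceed some constant
    larger than the infimum; by compactness one such constant would bound [g]
    below on the whole of [K]. *)
Lemma compact_lsc_argmin (R : realType) (T : topologicalType) (K : set T)
    (g : T -> R) :
  compact K -> K !=set0 -> (forall a, open [set x | a < g x]) ->
  exists2 x, K x & forall y, K y -> g x <= g y.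
Proof.
move=> K_compact [x0 Kx0] g_lsc; apply: contrapT => no_argmin.
have [a lt_a_g] := compact_lsc_lbound _ _ _ _ K_compact g_lsc.
have gK_lb : has_lbound (g @` K) by exists a => _ [x Kx <-]; exact/ltW/lt_a_g.
have inf_le x : K x -> inf (g @` K) <= g x.
  by move=> Kx; apply: ge_inf => //; exists x.
have inf_lt_g x : K x -> inf (g @` K) < g x.
  move=> Kx; rewrite lt_neqAle inf_le// andbT; apply/eqP => gx.
  by apply: no_argmin; exists x => // y Ky; rewrite -gx inf_le.
have /compact_near_coveringP K_cov := K_compact.
have : \forall c \near (inf (g @` K))^'+, K `<=` [set x | c < g x].
  apply: K_cov => x /inf_lt_g lt_gx.
  have [lt_b lt_b'] := midf_lt lt_gx; set b := _ / _ in lt_b lt_b'.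
  exists ([set y | b < g y], [set c | c < b]) => /=; last first.
    by move=> [y c] /= [gy cb]; exact: lt_trans cb gy.
  split; last exact: nbhs_right_lt.
  by apply: open_nbhs_nbhs; split; [exact: g_lsc|].
move=> /(filterI (nbhs_right_gt _)) /filter_ex[c [/= inf_c Kc]].
have [|_ [x Kx <-]] := inf_lt _ inf_c; first by exists (g x0), x0.
by rewrite ltNge ltW// Kc.
Qed.

(** * Set-valued maps with closed graph *)

(** The values near [s0] can leave [V] only within the compact set [K `\` V].
    No point [(s0, y)] with [y] there is in the graph, so the tube lemma, again
    as [near_covering], separates a whole neighbourhood of [s0] times that set
    from the graph. *)
Lemma closed_graph_usc (S T : topologicalType) (F : S -> set T) (s0 : S)
    (K : set T) :
  closed [set p | F p.1 p.2] -> compact K ->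
  (\forall s \near s0, F s `<=` K) -> upper_semicontinuous_at F s0.
Proof.
move=> graph_closed K_compact F_K V V_open F_V.
have /compact_near_coveringP K_cov : compact (K `&` ~` V).
  exact: compact_closedI (open_closedC V_open).
have : \forall s \near s0, K `&` ~` V `<=` [set y | ~ F s y].
  apply: K_cov => y [_ nVy].
  have : nbhs (s0, y) (~` [set p | F p.1 p.2]).
    apply: open_nbhs_nbhs; split; first exact: closed_openC.
    by move=> /F_V.
  move=> [[A B] /= [nA nB] AB].
  by exists (B, A) => // -[z s] /= [Bz As]; exact: (AB (s, z)).
apply: filterS2 F_K => s FK KnF y Fsy.
by apply: contrapT => nVy; apply: (KnF y) => //; split => //; exact: FK.
Qed.

Lemma closed_graph_outer_limit (S T : topologicalType) (F : S -> set T)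
    (s0 : S) :
  closed [set p | F p.1 p.2] -> outer_limit F s0 `<=` F s0.
Proof.
move=> graph_closed y [s_ [y_ [s_s0 y_y Fsy]]].
by apply: (closed_cvg (u_ := fun k => (s_ k, y_ k)) _ graph_closed _
  (s0, y) (cvg_pair s_s0 y_y)); apply: nearW.
Qed.

(** * Linear growth from the asymptotic hypothesis *)

Lemma limn_einf_le (R : realType) (u v : (\bar R)^nat) :
  (forall k, u k <= v k)%E -> (limn_einf u <= limn_einf v)%E.
Proof.
move=> le_uv; rewrite !limn_einf_lim.
apply: lee_lim; [exact: is_cvg_einfs|exact: is_cvg_einfs|].
apply: nearW => k; apply/ereal_infP => _ [l /= kl <-].
by apply: ge_ereal_inf; exists (u l) => //; exists l.
Qed.

Lemma closed_norm_le (R : realType) (n : nat) (r : R) :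
  closed [set x : 'rV[R]_n | `|x| <= r].
Proof.
apply: (@closed_comp _ _ (fun x : 'rV[R]_n => `|x|) [set a | a <= r]).
  by move=> x _; exact: norm_continuous.
exact: closed_le.
Qed.

Lemma compact_closedI_norm_le (R : realType) (n : nat) (A : set 'rV[R]_n)
    (r : R) :
  closed A -> compact (A `&` [set x | `|x| <= r]).
Proof.
move=> A_closed; apply: bounded_closed_compact.
  exists r; split; first exact: num_real.
  by move=> M /ltW rM x [_ /= xr]; exact: le_trans xr rM.
exact: closedI A_closed (@closed_norm_le _ _ _).
Qed.

(** The heart of the proof: a failure of linear growth at every rate
    [1 / k.+1] produces an asymptotic direction of [X], of norm 1, along which
    [phi] has a nonpositive slope at infinity. *)
Lemma linear_growth_outside_ball (R : realType) (n : nat) (X : set 'rV[R]_n)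
    (phi : 'rV[R]_n -> R) :
  (forall d, asymptotic_cone X d -> asymptotic_kernel phi d -> d = 0) ->
  exists c r : R,
    0 < c /\ forall x, X x -> r < `|x| -> c * `|x| < phi x.
Proof.
move=> cone_kernel; apply: contrapT => no_growth.
have /choice[x_ x_P] : forall k : nat, exists x,
    [/\ X x, k.+1%:R < `|x| & phi x <= k.+1%:R^-1 * `|x|].
  move=> k; apply: contrapT => no_x; apply: no_growth.
  exists k.+1%:R^-1, k.+1%:R; split=> // x Xx lt_kx.
  by rewrite ltNge; apply/negP => phi_le; apply: no_x; exists x.
have norm_gt0 k : 0 < `|x_ k|.
  by have [_ + _] := x_P k; exact: lt_trans.
pose d_ k := `|x_ k|^-1 *: x_ k.
have norm_d k : `|d_ k| = 1.
  by rewrite normrZ ger0_norm ?invr_ge0// mulVf// gt_eqF.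
have sphere_compact : compact [set d : 'rV[R]_n | `|d| = 1].
  apply: bounded_closed_compact.
    by exists 1; split=> // M /ltW M1 d /= ->.
  apply: (@closed_comp _ _ (fun x : 'rV[R]_n => `|x|) [set 1]).
    by move=> x _; exact: norm_continuous.
  exact: closed_eq.
have [|d [/= d1 d_cluster]] := sphere_compact (d_ @ \oo) _.
  by exists 0%N => // k _; exact: norm_d.
(* The selection [s] need not be increasing: [j <= s j] is enough both for
   [|x_ (s j)|] to tend to infinity and for the slopes to be below
   [harmonic j]. *)
have /choice[s sP] : forall j : nat, exists k : nat,
    (j <= k)%N /\ `|d - d_ k| < j.+1%:R^-1.
  move=> j.
  have [||_ [/= [k jk <-] dk]] := d_cluster (d_ @` [set k | (j <= k)%N])
    (ball d j.+1%:R^-1).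
  - by exists j => // k jk; exists k.
  - exact: nbhsx_ballx.
  - by exists k; split=> //; rewrite -ball_normE in dk.
have ds_d : d_ (s j) @[j --> \oo] --> d.
  apply/cvgrPdist_lt => e e0.
  have := near_infty_natSinv_lt (PosNum e0); apply: filterS => j /=.
  by apply: lt_trans; case: (sP j).
have t_y : `|x_ (s j)| @[j --> \oo] --> +oo.
  apply/cvgryPge => A; near=> j.
  apply: (@le_trans _ _ j%:R); first by near: j; exact: nbhs_infty_ger.
  have [js _] := sP j; have [_ lt_s _] := x_P (s j).
  by apply/ltW/(le_lt_trans _ lt_s); rewrite ler_nat ltnW.
have d0 : d = 0.
  apply: cone_kernel.
    by exists (fun j => `|x_ (s j)|), (x_ \o s); split=> // j; case: (x_P (s j)).
  have [harmonic0 _] := cvg_limn_einf_sup (@cvge_harmonic R).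
  rewrite /asymptotic_kernel /= -harmonic0.
  apply: (@le_trans _ _ (limn_einf (fun j =>
      (phi (`|x_ (s j)| *: d_ (s j)) / `|x_ (s j)|)%:E))).
    by apply: ereal_inf_lbound; exists (fun j => `|x_ (s j)|), (d_ \o s).
  apply: limn_einf_le => j; rewrite /= lee_fin.
  rewrite /d_ scalerA divff ?gt_eqF// scale1r ler_pdivrMr//.
  have [_ _ /le_trans] := x_P (s j); apply.
  rewrite ler_pM2r// lef_pV2 ?posrE// ler_nat ltnS.
  by case: (sP j).
by move: d1; rewrite d0 normr0 => /esym/eqP; rewrite oner_eq0.
Unshelve. all: by end_near. Qed.

Lemma linear_growth (R : realType) (n : nat) (X : set 'rV[R]_n)
    (phi : 'rV[R]_n -> R) :
  closed X -> (forall a, open [set x | a < phi x]) ->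
  (forall d, asymptotic_cone X d -> asymptotic_kernel phi d -> d = 0) ->
  exists c b : R,
    0 < c /\ forall x, X x -> c * `|x| - b <= phi x.
Proof.
move=> X_closed phi_lsc /linear_growth_outside_ball[c [r [c0 phi_gt]]].
have [a phi_gta] := compact_lsc_lbound _ _ _ _
  (compact_closedI_norm_le _ _ _ r X_closed) phi_lsc.
exists c, `|c * r - a|; split=> // x Xx.
have := ler_norm (c * r - a); have := normr_ge0 (c * r - a).
have [xr|rx] := leP `|x| r; last by have := phi_gt _ Xx rx; lra.
have : c * `|x| <= c * r by rewrite ler_pM2l.
by have := phi_gta x (conj Xx xr); lra.
Qed.

(** * The perturbed problems *)

Lemma component_perturb (R : realType) (m n : nat) (f : 'rV[R]_n -> 'rV[R]_m)
    (u : 'M[R]_(m, n)) i x :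
  component (perturb f u) i x = component f i x - inner (row i u) x.
Proof. by rewrite {1}/component mxE. Qed.

(** Joint lower semicontinuity of [(u, x) |-> f^u_i x], with a continuous
    threshold [h]: in the proof that the graph of [Sol^w] is closed, the
    comparison value [f^u_i x] at a fixed competitor [x] varies with [u]. *)
Lemma open_perturb_gt (R : realType) (m n : nat) (f : 'rV[R]_n -> 'rV[R]_m) i
    (h : 'M[R]_(m, n) * 'rV[R]_n -> R) :
  continuous h -> lower_semicontinuous (EFin \o component f i) ->
  open [set p | h p < component (perturb f p.1) i p.2].
Proof.
move=> h_cont f_lsc.
rewrite (_ : [set p | _] =
    [set p | h p + inner (row i p.1) p.2 < component f i p.2]).
  apply: (@open_continuous_lt_lsc R _ _ (fun p => component f i p.2)).
    move=> p; apply: (@continuousD _ _ _ h); first exact: h_cont.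
    exact: continuous_inner_row.
  move=> a; apply: (@open_comp _ _ snd [set x | a < component f i x]).
    by move=> p _; exact: cvg_snd.
  exact: lsc_open_gt.
by apply/seteqP; split=> p; rewrite /= component_perturb ltrBrDr.
Qed.

Lemma perturb_lsc (R : realType) (m n : nat) (f : 'rV[R]_n -> 'rV[R]_m) i
    (u : 'M[R]_(m, n)) :
  lower_semicontinuous (EFin \o component f i) ->
  forall a, open [set x | a < component (perturb f u) i x].
Proof.
move=> f_lsc a.
apply: (@open_comp _ _ (fun x => (u, x))
  [set p | a < component (perturb f p.1) i p.2]).
  by move=> x _; exact: continuous_pairr.
by apply: (@open_perturb_gt _ _ _ _ _ (fun=> a)) => // p; exact: cvg_cst.
Qed.

(** A point that is feasible but not weak Pareto is strictly improved in every
    objective by some fixed [x] in [X]; these finitely many strict inequalities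
    persist under small changes of both [u] and the point. *)
Lemma closed_graph_Solw (R : realType) (m n : nat) (X : set 'rV[R]_n)
    (f : 'rV[R]_n -> 'rV[R]_m) :
  closed X ->
  (forall i : 'I_m, lower_semicontinuous (EFin \o component f i)) ->
  closed [set p | Solw X f p.1 p.2].
Proof.
move=> X_closed f_lsc; rewrite -openC openE => p /= not_sol.
have [Xp|nXp] := pselect (X p.2); last first.
  have : \forall q \near p, ~ X q.2.
    apply: (@cvg_snd _ _ (nbhs p.1) (nbhs p.2) _ (~` X)).
    by apply: open_nbhs_nbhs; split; [exact: closed_openC|].
  by apply: filterS => q nXq [].
have [x [Xx x_lt]] : exists x, X x /\ forall i : 'I_m,
    component (perturb f p.1) i x < component (perturb f p.1) i p.2.
  by apply: contrapT => no_x; apply: not_sol.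
have near_lt (i : 'I_m) : \forall q \near p,
    component (perturb f q.1) i x < component (perturb f q.1) i q.2.
  apply: open_nbhs_nbhs; split; last exact: x_lt.
  apply: open_perturb_gt (f_lsc i).
  under eq_fun do rewrite component_perturb.
  move=> q; apply: (@continuousB _ _ _ (fun=> component f i x)
    (fun q : 'M[R]_(m, n) * 'rV[R]_n => inner (row i q.1) x)).
    exact: cst_continuous.
  apply: (@continuous_comp _ _ _
    (fun q : 'M[R]_(m, n) * 'rV[R]_n => (q.1, x))
    (fun q => inner (row i q.1) q.2)); last exact: continuous_inner_row.
  apply: (@continuous_pair _ _ _ fst (fun=> x)); last exact: cst_continuous.
  by move=> r; exact: cvg_fst.
by apply: filterS (filter_forall _ near_lt) => q q_lt [_]; apply; exists x.
Qed.

Lemma uniform_linear_growth (R : realType) (m n : nat) (X : set 'rV[R]_n)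
    (f : 'rV[R]_n -> 'rV[R]_m) :
  closed X ->
  (forall i : 'I_m, lower_semicontinuous (EFin \o component f i)) ->
  asymptotic_cone X `&` \bigcup_(i : 'I_m) asymptotic_kernel (component f i)
    `<=` [set 0] ->
  exists c b : R, 0 < c /\
    forall i x, X x -> c * `|x| - b <= component f i x.
Proof.
move=> X_closed f_lsc asym.
have /choice[c_ /choice[b_ cbP]] : forall i : 'I_m, exists c b : R, 0 < c /\
    forall x, X x -> c * `|x| - b <= component f i x.
  move=> i; apply: linear_growth => // [|d Xd fd]; first exact: lsc_open_gt.
  by apply: asym; split=> //; exists i.
exists (\big[Num.min/1]_i c_ i), (\big[Num.max/0]_i b_ i); split.
  by apply/bigmin_gtP; split=> // i _; case: (cbP i).
move=> i x Xx; have [_ /(_ x Xx)] := cbP i; apply: le_trans.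
by rewrite lerB ?ler_wpM2r ?bigmin_le ?le_bigmax.
Qed.

(** By [inner_row_le] the perturbation costs at most half of the slope. *)
Lemma perturb_linear_growth (R : realType) (m n : nat) (X : set 'rV[R]_n)
    (f : 'rV[R]_n -> 'rV[R]_m) (c b : R) (u : 'M[R]_(m, n)) :
  (forall i x, X x -> c * `|x| - b <= component f i x) ->
  n%:R * `|u| <= c / 2 ->
  forall i x, X x -> c / 2 * `|x| - b <= component (perturb f u) i x.
Proof.
move=> growth u_small i x Xx; rewrite component_perturb.
have /(le_trans (ler_norm _)) := inner_row_le _ _ _ u i x.
have : n%:R * `|u| * `|x| <= c / 2 * `|x| by rewrite ler_wpM2r.
by have := growth i x Xx; lra.
Qed.

(** As the weights sum to 1, the common lower bound [c * |x| - b] of the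
    components is inherited by their weighted mean. *)
Lemma linear_growth_coercive (R : realType) (m n : nat) (X : set 'rV[R]_n)
    (g : 'rV[R]_n -> 'rV[R]_m) (c b : R) (lam : 'rV[R]_m) :
  0 < c -> (forall i x, X x -> c * `|x| - b <= component g i x) ->
  weights lam -> coercive_on X (fun x => inner lam (g x)).
Proof.
move=> c0 growth [lam0 lam1] M.
exists (n%:R * ((M + b) / c)) => x Xx lt_x.
have : (M + b) / c < `|x|.
  rewrite ltNge; apply/negP => /(ler_wpM2l (ler0n R n)).
  by have := enorm_le _ _ x; lra.
rewrite ltr_pdivrMr// mulrC => lt_Mx.
apply: (@lt_le_trans _ _ (c * `|x| - b)); first lra.
rewrite -[leLHS]mul1r -lam1 mulr_suml; apply: ler_sum => i _.
by apply: ler_wpM2l; [exact: lam0|exact: growth].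
Qed.

Lemma argmin_weak_pareto (R : realType) (m n : nat) (X : set 'rV[R]_n)
    (g : 'rV[R]_n -> 'rV[R]_m) (i : 'I_m) (x : 'rV[R]_n) :
  X x -> (forall y, X y -> component g i x <= component g i y) ->
  weak_pareto X g x.
Proof.
move=> Xx x_min; split=> // -[y [Xy /(_ i)]].
by rewrite ltNge x_min.
Qed.

(** Linear growth of a single component confines its sublevel set at a point of
    [X] to a ball, so this component attains its minimum on [X]. *)
Lemma linear_growth_weak_pareto_nonempty (R : realType) (m n : nat)
    (X : set 'rV[R]_n) (g : 'rV[R]_n -> 'rV[R]_m) (c b : R) (i : 'I_m) :
  closed X -> X !=set0 -> 0 < c ->
  (forall x, X x -> c * `|x| - b <= component g i x) ->
  (forall a, open [set x | a < component g i x]) ->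
  weak_pareto X g !=set0.
Proof.
move=> X_closed [x0 Xx0] c0 growth g_lsc.
set r := (component g i x0 + b) / c.
have small_x x : X x -> component g i x <= component g i x0 -> `|x| <= r.
  move=> Xx gx; rewrite ler_pdivlMr// mulrC.
  by have := growth x Xx; lra.
have [|x [Xx _] x_min] := compact_lsc_argmin _ _ _ _
  (compact_closedI_norm_le _ _ _ r X_closed) _ g_lsc.
  by exists x0; split=> //; exact: small_x.
exists x; apply: (@argmin_weak_pareto _ _ _ _ _ i) => // y Xy.
have [yx0|/ltW x0y] := leP (component g i y) (component g i x0).
  by apply: x_min; split=> //; exact: small_x.
by apply: le_trans x0y; apply: x_min; split=> //; exact: small_x.
Qed.

(** Outside the ball the growth makes every component larger than at [x0], so
    [x0] strictly dominates. *)
Lemma linear_growth_weak_pareto_bounded (R : realType) (m n : nat)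
    (X : set 'rV[R]_n) (g : 'rV[R]_n -> 'rV[R]_m) (c b a : R) (x0 : 'rV[R]_n) :
  0 < c -> (forall i x, X x -> c * `|x| - b <= component g i x) ->
  X x0 -> (forall i, component g i x0 <= a) ->
  forall x, weak_pareto X g x -> `|x| <= (a + b) / c.
Proof.
move=> c0 growth Xx0 gx0 x [Xx x_pareto].
rewrite leNgt ltr_pdivrMr// mulrC; apply/negP => lt_x.
apply: x_pareto; exists x0; split=> // i.
by have := growth i x Xx; have := gx0 i; lra.
Qed.

Theorem theorem4p1 (R : realType) (m n : nat) (X : set 'rV[R]_n)
    (f : 'rV[R]_n -> 'rV[R]_m)
    (X_closed : closed X)
    (X_unbounded : ~ bounded_set X)
    (f_lsc : forall i : 'I_m, lower_semicontinuous (EFin \o component f i))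
    (X_f_asymptotic :
       asymptotic_cone X `&` \bigcup_(i : 'I_m) asymptotic_kernel (component f i)
       = [set 0]) :
  exists2 eps : R, 0 < eps &
    forall u : 'M[R]_(m, n), pert_norm u < eps ->
      [/\ bounded_below_on X (perturb f u),
          forall lam : 'rV[R]_m, weights lam ->
            coercive_on X (fun x => inner lam (perturb f u x)),
          Solw X f u !=set0 /\ compact (Solw X f u),
          outer_limit (Solw X f) 0 `<=` Solw X f 0 &
          upper_semicontinuous_at (Solw X f) 0].
Proof.
have [x0 Xx0] : X !=set0.
  apply/set0P/negP => /eqP X0; apply: X_unbounded; rewrite X0.
  by exists 0; split=> // M _ x [].
(* There is at least one objective: otherwise the union of kernels would be
   empty and could not contain 0. *)
have [i0] : inhabited 'I_m.
  have [_ [i _ _]] : (asymptotic_cone X `&`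
      \bigcup_(i : 'I_m) asymptotic_kernel (component f i)) 0.
    by rewrite X_f_asymptotic.
  by constructor.
have [c [b [c0 growth]]] : exists c b : R, 0 < c /\
    forall i x, X x -> c * `|x| - b <= component f i x.
  by apply: uniform_linear_growth => //; rewrite X_f_asymptotic.
(* With n.+1 instead of n the division is harmless also when n = 0. *)
pose eps := c / 2 / n.+1%:R.
have eps0 : 0 < eps by rewrite !divr_gt0.
have u_small (u : 'M[R]_(m, n)) : `|u| < eps -> n%:R * `|u| <= c / 2.
  rewrite ltr_pdivlMr// mulrC => /ltW; apply: le_trans.
  by rewrite ler_wpM2r// ler_nat.
have growth_u (u : 'M[R]_(m, n)) : `|u| < eps ->
    forall i x, X x -> c / 2 * `|x| - b <= component (perturb f u) i x.
  by move=> /u_small; exact: perturb_linear_growth.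
(* An upper bound of all [f^u_i x0], uniform in the small perturbations [u]. *)
pose a := \big[Num.max/0]_i component f i x0 + c / 2 * `|x0|.
pose r := (a + b) / (c / 2).
have c20 : 0 < c / 2 by rewrite divr_gt0.
have Solw_r (u : 'M[R]_(m, n)) : `|u| < eps ->
    Solw X f u `<=` X `&` [set x | `|x| <= r].
  move=> u_eps x sol_x; split; first by case: sol_x.
  apply: (@linear_growth_weak_pareto_bounded _ _ _ _ (perturb f u) _ _ _ x0)
    sol_x => //; first exact: growth_u.
  move=> i; rewrite component_perturb.
  apply: lerD; first exact: le_bigmax.
  apply: le_trans (ler_norm _) _; rewrite normrN.
  apply: le_trans (inner_row_le _ _ _ _ _ _) _.
  by rewrite ler_wpM2r// u_small.
have graph_closed := closed_graph_Solw _ _ _ _ _ X_closed f_lsc.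
have X_r_compact := compact_closedI_norm_le _ _ _ r X_closed.
exists eps => // u /(le_lt_trans (mx_norm_le_pert_norm _ _ _ u)) u_eps.
split.
- exists (const_mx (- b)) => _ [x Xx <-]; exists (perturb f u x - const_mx (- b)).
    move=> i; have := growth_u u u_eps i x Xx.
    rewrite {1}/component !mxE.
    have : 0 <= c / 2 * `|x| by rewrite mulr_ge0// ltW.
    lra.
  by rewrite addrC subrK.
- move=> lam; exact: linear_growth_coercive (growth_u u u_eps).
- split.
    apply: (@linear_growth_weak_pareto_nonempty _ _ _ _ _ (c / 2) b i0) => //.
    - by exists x0.
    - exact: growth_u.
    - exact: perturb_lsc.
  apply: (subclosed_compact _ X_r_compact (Solw_r u u_eps)).
  apply: (@closed_comp _ _ (fun x => (u, x)) [set p | Solw X f p.1 p.2]) => //.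
  by move=> x _; exact: continuous_pairr.
- exact: closed_graph_outer_limit.
- apply: closed_graph_usc graph_closed X_r_compact _.
  by apply: filterS (nbhs0_lt eps0); exact: Solw_r.
Qed.
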